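(* Let $p\ge2$ and let $\varphi:\mathbb{R}^n\to\mathbb{R}\cup\{+\infty\}$ be proper and lower semicontinuous. Suppose $\bar x=0$ is a $p$-calm point of $\varphi$ with constant $M>0$, $\varphi(0)=0$, and $\varphi$ is $q$-prox-regular with some $q\ge p$ at $\bar x=0$ for $\bar\zeta=0\in\partial\varphi(0)$ with constants $\varepsilon>0$ and $\rho>0$. Then for each $\gamma\in\big(0,\min\{\frac{2^{1-p}}{Mp},\frac1{\rho2^{2p-3}}\}\big)$ there exists a neighbourhood $U$ of $0$ such that $\operatorname{prox}^p_{\gamma\varphi}$ is single-valued and continuous on $U$ and $\varphi^p_\gamma\in C^1(U)$.
   Context: $\operatorname{prox}^p_{\gamma\varphi}(x):=\operatorname{argmin}_{y}\big(\varphi(y)+\frac{1}{p\gamma}\|x-y\|^p\big)$, $\varphi^p_\gamma(x):=\inf_y\big(\varphi(y)+\frac{1}{p\gamma}\|x-y\|^p\big)$. $\bar x$ is a $p$-calm point with constant $M>0$ if $\varphi(x)+M\|x-\bar x\|^p>\varphi(\bar x)$ for all $x\neq\bar x$. $\partial$ denotes the Mordukhovich (limiting) subdifferential. $\varphi$ is $q$-prox-regular ($q\ge2$) at $\bar x\in\operatorname{dom}\varphi$ for $\bar\zeta\in\partial\varphi(\bar x)$ with constants $\varepsilon>0,\rho\ge0$ if $\varphi(x')\ge\varphi(x)+\langle\zeta,x'-x\rangle-\frac\rho2\|x'-x\|^q$ for all $x'\in\mathbb{B}(\bar x;\varepsilon)$, whenever $x\in\mathbb{B}(\bar x;\varepsilon)$,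 $\zeta\in\partial\varphi(x)\cap\mathbb{B}(\bar\zeta;\varepsilon)$ and $\varphi(x)<\varphi(\bar x)+\varepsilon$. *)

(* Defs.v *)
(* R^n is 'rV[R]_n equipped with the
   Euclidean norm/inner product defined below (the library topology on 'rV_n,
   i.e. the sup-norm topology, coincides with the Euclidean one). *)
From HB Require Import structures.
From mathcomp Require Import all_boot all_order all_algebra.
From mathcomp Require Import all_classical all_reals all_analysis.
Set Implicit Arguments. Unset Strict Implicit. Unset Printing Implicit Defensive.
Import Order.TTheory GRing.Theory Num.Theory.
Import numFieldNormedType.Exports.
Local Open Scope classical_set_scope.
Local Open Scope ring_scope.

Section Defs.
Context {R : realType} {n : nat}.
Notation V := 'rV[R]_n.

Definition ip (u v : V) : R := \sum_(i < n) u ord0 i * v ord0 i.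
Definition enorm (u : V) : R := Num.sqrt (ip u u).

Definition proper_fun (f : V -> \bar R) : Prop :=
  (forall x, f x != -oo%E) /\ (exists x, f x \is a fin_num).

Definition frechet_subgrad (f : V -> \bar R) (x z : V) : Prop :=
  f x \is a fin_num /\
  forall eps : R, 0 < eps -> exists2 delta : R, 0 < delta &
    forall y : V, enorm (y - x) < delta ->
      (f x + (ip z (y - x) - eps * enorm (y - x))%:E <= f y)%E.

Definition limiting_subgrad (f : V -> \bar R) (x z : V) : Prop :=
  f x \is a fin_num /\
  exists (xk zk : nat -> V),
    [/\ xk @ \oo --> x, (fun k => f (xk k)) @ \oo --> f x, zk @ \oo --> z
      & forall k, frechet_subgrad f (xk k) (zk k)].

Definition p_calm (f : V -> \bar R) (p M : R) (xbar : V) : Prop :=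
  forall x, x != xbar -> (f xbar < f x + (M * enorm (x - xbar) `^ p)%:E)%E.

Definition q_prox_regular (f : V -> \bar R) (q : R) (xbar zbar : V)
    (eps rho : R) : Prop :=
  forall (x z : V), enorm (x - xbar) <= eps -> limiting_subgrad f x z ->
    enorm (z - zbar) <= eps -> (f x < f xbar + eps%:E)%E ->
  forall x' : V, enorm (x' - xbar) <= eps ->
    (f x + (ip z (x' - x) - rho / 2 * enorm (x' - x) `^ q)%:E <= f x')%E.

Definition moreau_obj (f : V -> \bar R) (p gamma : R) (x y : V) : \bar R :=
  (f y + (enorm (x - y) `^ p / (p * gamma))%:E)%E.

Definition prox (f : V -> \bar R) (p gamma : R) (x : V) : set V :=
  [set y | forall y', (moreau_obj f p gamma x y <= moreau_obj f p gamma x y')%E].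

Definition envelope (f : V -> \bar R) (p gamma : R) (x : V) : \bar R :=
  ereal_inf [set moreau_obj f p gamma x y | y in setT].

Definition C1_on (U : set V) (g : V -> R) : Prop :=
  exists G : V -> V,
    (forall x, U x -> {for x, continuous G}) /\
    (forall x, U x -> forall eps : R, 0 < eps -> exists2 delta : R, 0 < delta &
       forall y, enorm (y - x) < delta ->
         `|g y - g x - ip (G x) (y - x)| <= eps * enorm (y - x)).

End Defs.

(* Main.v *)
Require Import Defs.
From HB Require Import structures.
From mathcomp Require Import all_boot all_order all_algebra ring lra.
From mathcomp Require Import all_classical all_reals all_analysis.
Import Order.TTheory GRing.Theory Num.Theory.
Import numFieldNormedType.Exports.
Local Open Scope classical_set_scope.
Local Open Scope ring_scope.

(* Calmness and convexity of |.|^p make the objective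
   F_x(y) = phi y + |x - y|^p / (p gamma) coercive, so minimizers exist and tend
   to 0 with x. By Fermat's rule T(x - y) / gamma, with T u = |u|^(p-2) u, is a
   subgradient of phi at a minimizer y, and prox-regularity applies there.
   Added to the uniform convexity inequality
   |v|^p >= |u|^p + p <T u, v - u> + 2^(1-p) |v - u|^p, a consequence of
   Clarkson's inequality, it gives the growth estimate
   F_x(y') >= F_x(y) + c |y' - y|^p with
   c = 2^(1-p) / (p gamma) - rho / 2; the bound on gamma and p <= 2^(p-1) make
   c > 0. Growth yields uniqueness and Hoelder continuity of the minimizer P x.
   Testing F_x with P x' and F_x' with P x squeezes the increment of the envelope
   between <T(x - P x'), x' - x> / gamma and <T(x' - P x), x' - x> / gamma, so
   its gradient is T(x - P x) / gamma. *)

(** * Inequalities for real powers of nonnegative numbers *)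

Section RealPowers.
Context {R : realType}.
Implicit Types a b x y p s : R.

(** Young's inequality for a^(p-1) and b with conjugate exponents p/(p-1) and p, cleared of
    denominators. At p = 1 the first exponent degenerates, hence the separate case. *)
Lemma young_powR {p a b} : 1 <= p -> 0 <= a -> 0 <= b ->
  p * (a `^ (p - 1) * b) <= b `^ p + (p - 1) * a `^ p.
Proof.
rewrite le_eqVlt => /predU1P[<-|p1] a0 b0.
  by rewrite subrr powRr0 powRr1// mul0r !mul1r addr0.
have p0 : 0 < p by lra.
have q0 : 0 < p / (p - 1) by rewrite divr_gt0// subr_gt0.
have := @conjugate_powR R b (a `^ (p - 1)) p (p / (p - 1)) b0 (powR_ge0 _ _) p0 q0.
have pN0 : p != 0 by rewrite gt_eqF.
have p1N0 : p - 1 != 0 by rewrite subr_eq0 gt_eqF.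
rewrite -powRrM mulrCA divff// mulr1.
have -> : p^-1 + (p / (p - 1))^-1 = 1 by field; rewrite p1N0 pN0.
move=> /(_ erefl); rewrite -(ler_pM2l p0) [b * _]mulrC => /le_trans; apply.
by rewrite le_eqVlt; apply/predU1P; left; field; rewrite p1N0 pN0.
Qed.

Lemma powR_tangent {p a b} : 1 <= p -> 0 <= a -> 0 <= b ->
  a `^ p + p * (a `^ (p - 1) * (b - a)) <= b `^ p.
Proof.
move=> p1 a0 b0; have := young_powR p1 a0 b0.
have : a * a `^ (p - 1) = a `^ p by rewrite mulr_powRB1//; lra.
nra.
Qed.

(** Write t^s = t * t^(s-1) and use that t^(s-1) is nondecreasing. *)
Lemma powR_superadditive {s x y} : 1 <= s -> 0 <= x -> 0 <= y ->
  x `^ s + y `^ s <= (x + y) `^ s.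
Proof.
move=> s1 x0 y0; have s0 : 0 < s by lra.
rewrite -(mulr_powRB1 x0 s0) -(mulr_powRB1 y0 s0).
rewrite -(mulr_powRB1 (addr_ge0 x0 y0) s0) mulrDl.
by apply: lerD; apply: ler_wpM2l => //; apply: ge0_ler_powR;
  rewrite ?nnegrE; lra.
Qed.

(** In the sum of the two tangent inequalities at the midpoint, the linear terms cancel. *)
Lemma powR_midpoint {s x y} : 1 <= s -> 0 <= x -> 0 <= y ->
  ((x + y) / 2) `^ s <= (x `^ s + y `^ s) / 2.
Proof.
move=> s1 x0 y0; have m0 : 0 <= (x + y) / 2 by lra.
have := powR_tangent s1 m0 x0; have := powR_tangent s1 m0 y0.
set z := (_ `^ (s - 1)); nra.
Qed.

(** Young's inequality with exponent p - 1 at a = 1, b = 2. It serves to compare the bound on gamma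
    that involves rho with the modulus of uniform convexity. *)
Lemma ge2_le_pow2B1 {p} : 2 <= p -> p <= 2 `^ (p - 1).
Proof.
move=> p2.
have := @young_powR (p - 1) 1 2 ltac:(lra) ltac:(lra) ltac:(lra).
by rewrite !powR1; lra.
Qed.

Lemma powR_continuous_gt0 s a : 0 < a -> {for a, continuous (@powR R ^~ s)}.
Proof.
move=> a0; apply: differentiable_continuous; apply/derivable1_diffP.
by apply: derivable_powR; rewrite in_itv /= a0.
Qed.

Lemma powR_le1_anti {a x y} : 0 <= a <= 1 -> 0 < y -> y <= x -> a `^ x <= a `^ y.
Proof.
move=> /andP[a0 a1] y0 yx; move: a0; rewrite le_eqVlt => /predU1P[<-|a0].
  by rewrite !powR0// gt_eqF//; lra.
by apply: ger_powR => //; rewrite a0.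
Qed.

End RealPowers.

(** * The Euclidean norm and its agreement with the sup-norm topology *)

Section Euclidean.
Context {R : realType} {n : nat}.
Implicit Types u v w x y : 'rV[R]_n.

Lemma ipC u v : ip u v = ip v u.
Proof. by apply: eq_bigr => i _; rewrite mulrC. Qed.

Lemma ipDl u v w : ip (u + v) w = ip u w + ip v w.
Proof. by rewrite /ip -big_split; apply: eq_bigr => i _; rewrite mxE mulrDl. Qed.

Lemma ipZl (a : R) u v : ip (a *: u) v = a * ip u v.
Proof. by rewrite /ip mulr_sumr; apply: eq_bigr => i _; rewrite mxE mulrA. Qed.

Lemma ipNl u v : ip (- u) v = - ip u v.
Proof. by rewrite -scaleN1r ipZl mulN1r. Qed.

Lemma ipDr u v w : ip u (v + w) = ip u v + ip u w.
Proof. by rewrite ipC ipDl !(ipC u). Qed.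

Lemma ipZr (a : R) u v : ip u (a *: v) = a * ip u v.
Proof. by rewrite ipC ipZl ipC. Qed.

Lemma ipNr u v : ip u (- v) = - ip u v.
Proof. by rewrite ipC ipNl ipC. Qed.

Lemma ip_ge0 u : 0 <= ip u u.
Proof. by apply: sumr_ge0 => i _; rewrite -expr2 sqr_ge0. Qed.

Lemma enorm_ge0 u : 0 <= enorm u.
Proof. exact: sqrtr_ge0. Qed.

Lemma sqr_enorm u : enorm u ^+ 2 = ip u u.
Proof. by rewrite sqr_sqrtr ?ip_ge0. Qed.

Lemma enormZ (a : R) u : enorm (a *: u) = `|a| * enorm u.
Proof.
by rewrite /enorm ipZl ipZr mulrA -expr2 sqrtrM ?sqr_ge0// sqrtr_sqr.
Qed.

Lemma enormN u : enorm (- u) = enorm u.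
Proof. by rewrite -scaleN1r enormZ normrN1 mul1r. Qed.

Lemma enorm_distC u v : enorm (u - v) = enorm (v - u).
Proof. by rewrite -enormN opprB. Qed.

Lemma normr_coord_le_enorm u i : `|u ord0 i| <= enorm u.
Proof.
rewrite -sqrtr_sqr ler_wsqrtr// /ip (bigD1 i)//= -expr2 lerDl.
by apply: sumr_ge0 => j _; rewrite -expr2 sqr_ge0.
Qed.

Lemma enorm0 : enorm (0 : 'rV[R]_n) = 0.
Proof. by rewrite -(scale0r 0) enormZ normr0 mul0r. Qed.

Lemma enorm_eq0 u : (enorm u == 0) = (u == 0).
Proof.
apply/eqP/eqP => [u0|->]; last exact: enorm0.
apply/rowP => i; rewrite mxE; apply/eqP; rewrite -normr_eq0.
by rewrite eq_le normr_ge0 andbT -u0 normr_coord_le_enorm.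
Qed.

Lemma enorm_gt0 u : (0 < enorm u) = (u != 0).
Proof. by rewrite lt0r enorm_eq0 enorm_ge0 andbT. Qed.

Lemma cauchy_schwarz u v : ip u v <= enorm u * enorm v.
Proof.
have [->|u0] := eqVneq u 0.
  by rewrite enorm0 mul0r -(scale0r 0) ipZl mul0r.
have [->|v0] := eqVneq v 0.
  by rewrite enorm0 mulr0 -(scale0r 0) ipZr mul0r.
(* This square expands to 2|u||v| (|u||v| - <u, v>). *)
have := ip_ge0 (enorm v *: u - enorm u *: v).
rewrite !(ipDl, ipDr, ipNl, ipNr, ipZl, ipZr) -!sqr_enorm (ipC v u).
have uv : 0 < enorm u * enorm v by rewrite mulr_gt0 ?enorm_gt0.
rewrite (_ : _ + _ = (2 * (enorm u * enorm v)) * (enorm u * enorm v - ip u v));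
  last by ring.
by rewrite pmulr_rge0 ?subr_ge0// mulr_gt0.
Qed.

Lemma normr_ip u v : `|ip u v| <= enorm u * enorm v.
Proof.
rewrite ler_norml cauchy_schwarz andbT lerNl -ipNl.
by rewrite -(enormN u) cauchy_schwarz.
Qed.

Lemma ler_enormD u v : enorm (u + v) <= enorm u + enorm v.
Proof.
rewrite -(@ler_pXn2r _ 2)// ?nnegrE ?addr_ge0 ?enorm_ge0//.
rewrite sqrrD !sqr_enorm !(ipDl, ipDr) (ipC v u).
by have := cauchy_schwarz u v; lra.
Qed.

Lemma ler_enorm_dist u v : `|enorm u - enorm v| <= enorm (u - v).
Proof.
have := ler_enormD (u - v) v; have := ler_enormD (v - u) u.
by rewrite !subrK (enorm_distC v) ler_norml; lra.
Qed.

Lemma mx_norm_le_enorm u : `|u| <= enorm u.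
Proof.
rewrite [`|u|]/Num.norm /= mx_normrE; apply/bigmax_leP; split=> [|[i j] _ /=].
  exact: enorm_ge0.
by rewrite ord1 normr_coord_le_enorm.
Qed.

Lemma normr_coord_le_mx_norm u i : `|u ord0 i| <= `|u|.
Proof.
rewrite [leRHS]/Num.norm /= mx_normrE; apply/bigmax_geP; right.
by exists (ord0, i).
Qed.

(** The crude factor n + 1, instead of the square root of n, is positive even for n = 0, so
    [nbhs_enormP] can divide by it. *)
Lemma enorm_le_mx_norm u : enorm u <= n.+1%:R * `|u|.
Proof.
rewrite -(@ler_pXn2r _ 2)// ?nnegrE ?mulr_ge0 ?enorm_ge0// sqr_enorm.
apply: (@le_trans _ _ (n%:R * `|u| ^+ 2)).
  rewrite mulr_natl -[X in _ *+ X]card_ord -sumr_const; apply: ler_sum => i _.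
  rewrite -expr2 -real_normK ?num_real//.
  by rewrite ler_pXn2r ?nnegrE// normr_coord_le_mx_norm.
rewrite exprMn ler_wpM2r ?sqr_ge0// -natrX ler_nat.
by rewrite (leq_trans (leqnSn n))// leq_pmull.
Qed.

Lemma nbhs_enormP x (A : set 'rV[R]_n) :
  nbhs x A <-> exists2 d : R, 0 < d & forall y, enorm (y - x) < d -> A y.
Proof.
split=> [/nbhs_ballP[d /= d0 dA]|[d d0 dA]].
  exists d => // y yx; apply: dA; rewrite -ball_normE /= distrC.
  exact: le_lt_trans (mx_norm_le_enorm _) yx.
apply/nbhs_ballP; exists (d / n.+1%:R) => /=; first by rewrite divr_gt0.
move=> y; rewrite -ball_normE /= distrC ltr_pdivlMr// mulrC => yx.
exact/dA/(le_lt_trans (enorm_le_mx_norm _)).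
Qed.

Lemma continuous_enormP (f : 'rV[R]_n -> 'rV[R]_n) x :
  {for x, continuous f} <->
  forall e : R, 0 < e -> exists2 d : R, 0 < d &
    forall y, enorm (y - x) < d -> enorm (f y - f x) < e.
Proof.
split=> [cf e e0|cf A /nbhs_enormP[e e0 eA]].
  have /cf/nbhs_enormP[d d0 dA] : nbhs (f x) [set z | enorm (z - f x) < e].
    by apply/nbhs_enormP; exists e.
  by exists d.
have [d d0 dA] := cf _ e0.
by apply/nbhs_enormP; exists d => // y /dA /eA.
Qed.

Lemma enorm_continuous : continuous (@enorm R n).
Proof.
move=> x A /nbhs_ballP[e /= e0 eA]; apply/nbhs_enormP; exists e => // y yx.
apply: eA; rewrite -ball_normE /= distrC.
exact: le_lt_trans (ler_enorm_dist _ _) yx.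
Qed.

Lemma compact_enorm_ball (r : R) : compact [set y : 'rV[R]_n | enorm y <= r].
Proof.
apply: bounded_closed_compact.
  exists r; split; first exact: num_real.
  move=> s rs y /= yr; exact/(le_trans (mx_norm_le_enorm _))/(le_trans yr)/ltW.
have -> : [set y : 'rV[R]_n | enorm y <= r] = enorm @^-1` [set t : R | t <= r] by [].
apply: preimage_closed; last exact: closed_le.
by move=> x _; exact: enorm_continuous.
Qed.

End Euclidean.

(** * Uniform convexity of the p-th power of the norm, and its gradient *)

Section DualityMap.
Context {R : realType} {n : nat}.
Implicit Types (u v w x y : 'rV[R]_n) (p : R).

(* [p * pgrad p u] is the gradient of [enorm ^ p] at [u]; for [p = 2] the
   convention [0 `^ 0 = 1] makes [pgrad] the identity, also at [0]. *)
Definition pgrad p u : 'rV[R]_n := enorm u `^ (p - 2) *: u.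

Lemma mulr_powRB2 {p} {a : R} : 2 <= p -> 0 <= a -> a `^ (p - 2) * a = a `^ (p - 1).
Proof.
move=> p2 a0; rewrite mulrC -(@mulr_powRB1 _ a (p - 1))//; last by lra.
by congr (_ * _ `^ _); lra.
Qed.

Lemma enorm_pgrad {p} u : 2 <= p -> enorm (pgrad p u) = enorm u `^ (p - 1).
Proof.
move=> p2; rewrite enormZ ger0_norm ?powR_ge0//.
by rewrite mulr_powRB2 ?enorm_ge0.
Qed.

Lemma ip_pgrad {p} u : 2 <= p -> ip (pgrad p u) u = enorm u `^ p.
Proof.
move=> p2; rewrite ipZl -sqr_enorm expr2 mulrA mulr_powRB2 ?enorm_ge0//.
by rewrite mulrC mulr_powRB1 ?enorm_ge0//; lra.
Qed.

(** By Cauchy-Schwarz <T u, v> is at most |u|^(p-1) |v|, and Young's inequality bounds this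
    product. *)
Lemma enorm_powR_tangent {p} u v : 2 <= p ->
  enorm u `^ p + p * ip (pgrad p u) (v - u) <= enorm v `^ p.
Proof.
move=> p2; rewrite ipDr ipNr ip_pgrad//.
have p1 : 1 <= p by lra.
have := young_powR p1 (enorm_ge0 u) (enorm_ge0 v).
have : p * ip (pgrad p u) v <= p * (enorm u `^ (p - 1) * enorm v).
  by rewrite ler_pM2l ?(le_trans (cauchy_schwarz _ _)) ?enorm_pgrad//; lra.
lra.
Qed.

Lemma enorm_powR2 u p : enorm u `^ p = ip u u `^ (p / 2).
Proof.
rewrite -sqr_enorm -powR_mulrn ?enorm_ge0// -powRrM.
by congr (_ `^ _); field.
Qed.

(** Since p/2 >= 1, the map t^(p/2) is superadditive and midpoint convex; the parallelogram identity
    links the two estimates. *)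
Lemma enorm_powR_clarkson {p} u v : 2 <= p ->
  enorm (2^-1 *: (u + v)) `^ p + enorm (2^-1 *: (u - v)) `^ p
    <= (enorm u `^ p + enorm v `^ p) / 2.
Proof.
move=> p2; rewrite !enorm_powR2; have s1 : 1 <= p / 2 by lra.
apply: le_trans (powR_superadditive s1 (ip_ge0 _) (ip_ge0 _)) _.
apply: le_trans (powR_midpoint s1 (ip_ge0 _) (ip_ge0 _)).
rewrite le_eqVlt; apply/predU1P; left; congr (_ `^ _).
by rewrite !(ipDl, ipDr, ipNl, ipNr, ipZl, ipZr) (ipC v u); field.
Qed.

Lemma enorm_half_powR u p : enorm (2^-1 *: u) `^ p = 2 `^ (- p) * enorm u `^ p.
Proof.
rewrite enormZ ger0_norm ?invr_ge0// powRM ?invr_ge0 ?enorm_ge0//.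
by rewrite -{1}(@powR_inv1 _ 2)// -powRrM mulN1r.
Qed.

Lemma powR2_oneB p : 2 `^ (1 - p) = 2 * 2 `^ (- p) :> R.
Proof. by rewrite powRD ?powRr1// pnatr_eq0 implybT. Qed.

(** Clarkson's inequality without its difference term; it yields the coercivity of the proximal
    objective. *)
Lemma enorm_powR_convex {p} u v : 2 <= p ->
  2 `^ (1 - p) * enorm (u + v) `^ p <= enorm u `^ p + enorm v `^ p.
Proof.
move=> p2; have := enorm_powR_clarkson u v p2.
rewrite !enorm_half_powR powR2_oneB.
have : 0 <= 2 `^ (- p) * enorm (u - v) `^ p by rewrite mulr_ge0 ?powR_ge0.
rewrite -mulrA; move: (_ * enorm (u + v) `^ p) (_ * enorm (u - v) `^ p).
by move: (_ `^ p) (_ `^ p) => a b c d; lra.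
Qed.

(** Clarkson bounds the power at the midpoint of u and v from above, the tangent inequality at u
    bounds it from below. Doubling the combination turns 2^(-p) into 2^(1-p). *)
Lemma enorm_powR_uniform_convex {p} u v : 2 <= p ->
  enorm u `^ p + p * ip (pgrad p u) (v - u) + 2 `^ (1 - p) * enorm (v - u) `^ p
    <= enorm v `^ p.
Proof.
move=> p2; have := enorm_powR_clarkson v u p2.
have := enorm_powR_tangent u (2^-1 *: (v + u)) p2.
rewrite (_ : _ *: (v + u) - u = 2^-1 *: (v - u)); last first.
  by apply/rowP => i; rewrite !mxE; lra.
rewrite ipZr (enorm_half_powR (v - u)) powR2_oneB -mulrA mulrCA.
move: (p * ip _ _) (_ * enorm (v - u) `^ p) (enorm _ `^ p) => a b c.
by move: (enorm u `^ p) (enorm v `^ p) => d e; lra.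
Qed.

Lemma pgrad_continuous p : 2 <= p -> continuous (pgrad p).
Proof.
move=> p2 u; have [->|u0] := eqVneq u 0.
  (* At 0 the scalar factor is not handled by continuity of powers; instead |T y| = |y|^(p-1) <= |y|
     when |y| <= 1, because p - 1 >= 1. *)
  apply/continuous_enormP => e e0; exists (Num.min 1 e).
    by rewrite lt_min ltr01.
  move=> y; rewrite lt_min subr0 => /andP[y1 ye].
  rewrite {2}/pgrad scaler0 subr0 enorm_pgrad//.
  apply: le_lt_trans ye.
  rewrite -[leRHS]powRr1 ?enorm_ge0//.
  apply: powR_le1_anti => //; last by lra.
  by rewrite enorm_ge0 ltW.
have cpow : {for enorm u, continuous (@powR R ^~ (p - 2))}.
  by apply: powR_continuous_gt0; rewrite enorm_gt0.
exact: (cvgZ (continuous_comp (@enorm_continuous R n u) cpow) cvg_id).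
Qed.

End DualityMap.

(** * Attainment of minima, and elementary facts on extended reals and subgradients *)

Lemma lower_semicontinuous_attains_min {R : realType} {T : topologicalType}
    (f : T -> \bar R) (K : set T) :
  (forall x, f x != -oo%E) -> lower_semicontinuous f -> compact K -> K !=set0 ->
  exists2 y, K y & forall z, K z -> (f y <= f z)%E.
Proof.
move=> fNy lscf cK [z0 Kz0].
(* The sublevel sets of values attained on K are nested, so they generate a proper filter. A cluster
   point y is a minimizer: if f z < f y, semicontinuity gives a neighbourhood of y that misses the
   sublevel set of z. *)
pose F : set_system T :=
  [set S | exists2 z, K z & forall y, K y -> (f y <= f z)%E -> S y].
have FF : ProperFilter F.
  apply: Build_ProperFilter_ex => [S [z Kz zS]|]; first by exists z; apply: zS.
  split=> [|S S' [z Kz zS] [z' Kz' zS']|S S' SS' [z Kz zS]].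
  - by exists z0.
  - have [zz'|/ltW z'z] := leP (f z) (f z').
      exists z => // y Ky yz; split; first exact: zS.
      exact/zS'/(le_trans yz zz').
    exists z' => // y Ky yz'; split; last exact: zS'.
    exact/zS/(le_trans yz' z'z).
  - by exists z => // y Ky yz; exact/SS'/zS.
have [y [Ky Fy]] : (K `&` cluster F) !=set0 by apply: cK; exists z0.
exists y => // z Kz; rewrite leNgt; apply/negP => zy.
(* Semicontinuity is stated with real thresholds, so f z must first be shown to be finite. *)
have [a fza] : exists a, f z = a%:E.
  by move: (fNy z) zy; case: (f z) => [a _ _|_|//]; [exists a|rewrite ltNge leey].
rewrite fza in zy; have [V yV Va] := lscf _ _ zy.
have Fz : F (K `&` [set w | (f w <= f z)%E]) by exists z.
have [w [[Kw /= wz] /Va]] := Fy _ _ Fz yV.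
by rewrite ltNge -fza wz.
Qed.

Lemma lte_fin_gap {R : realType} (b : R) (t : \bar R) :
  (b%:E < t)%E -> exists2 d : R, 0 < d & ((b + d)%:E < t)%E.
Proof.
case: t => [r||//]; last by exists 1 => //; rewrite ltry.
rewrite lte_fin => br; exists ((r - b) / 2); first by lra.
by rewrite lte_fin; lra.
Qed.

Lemma frechet_subgrad_limiting {R : realType} {n : nat}
    (f : 'rV[R]_n -> \bar R) x z :
  frechet_subgrad f x z -> limiting_subgrad f x z.
Proof.
move=> fxz; split; first by case: fxz.
by exists (fun=> x), (fun=> z); split=> //; exact: cvg_cst.
Qed.

(** * The proximal penalty and Fermat's rule *)

Section Penalty.
Context {R : realType} {n : nat} {p gamma : R}.
Hypotheses (p2 : 2 <= p) (gamma0 : 0 < gamma).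
Implicit Types (u v x y : 'rV[R]_n) (phi : 'rV[R]_n -> \bar R).

Definition pen u : R := enorm u `^ p / (p * gamma).
(** The gradient of [pen]: the factor p from differentiating the power cancels the p in the
    denominator. *)
Definition pen_grad u : 'rV[R]_n := gamma^-1 *: pgrad p u.

Let p0 : 0 < p. Proof. exact: lt_le_trans p2. Qed.
Let pgamma0 : 0 < p * gamma. Proof. by rewrite mulr_gt0. Qed.

Lemma pen_uniform_convex u v :
  pen u + ip (pen_grad u) (v - u)
    + 2 `^ (1 - p) / (p * gamma) * enorm (v - u) `^ p <= pen v.
Proof.
rewrite /pen ler_pdivlMr//; apply: le_trans (enorm_powR_uniform_convex u v p2).
rewrite ipZl le_eqVlt; apply/predU1P; left; field.
by rewrite !gt_eqF.
Qed.

Lemma pen_tangent u v : pen u + ip (pen_grad u) (v - u) <= pen v.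
Proof.
apply: le_trans (pen_uniform_convex u v).
by rewrite lerDl mulr_ge0 ?divr_ge0 ?powR_ge0// ltW.
Qed.

Lemma pen_grad_continuous : continuous pen_grad.
Proof. move=> u; exact: (cvgZ (cvg_cst _) (@pgrad_continuous _ _ _ p2 u)). Qed.

Lemma enorm_pen_grad u : enorm (pen_grad u) = enorm u `^ (p - 1) / gamma.
Proof. by rewrite enormZ enorm_pgrad// gtr0_norm ?invr_gt0// mulrC. Qed.

(** By the tangent inequality at u, only the gradient at u matters, and its norm |u|^(p-1) / gamma
    is at most 1 / gamma; v need not be bounded. *)
Lemma pen_lip u v : enorm u <= 1 -> pen u - pen v <= enorm (u - v) / gamma.
Proof.
move=> u1; have := pen_tangent u v; have := cauchy_schwarz (pen_grad u) (u - v).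
rewrite -[v - u]opprB ipNr enorm_pen_grad.
have : enorm u `^ (p - 1) / gamma * enorm (u - v) <= enorm (u - v) / gamma.
  rewrite mulrAC ler_pM2r ?invr_gt0// ler_piMl ?enorm_ge0//.
  rewrite -[leRHS](congr1 (fun f => f (p - 1)) (@powR1 R)).
  by apply: ge0_ler_powR; rewrite ?nnegrE ?enorm_ge0//; have := p2; lra.
lra.
Qed.

Lemma moreau_objE phi x y :
  moreau_obj phi p gamma x y = (phi y + (pen (x - y))%:E)%E.
Proof. by []. Qed.

Lemma moreau_obj_lsc phi x :
  (forall y, phi y != -oo%E) -> lower_semicontinuous phi ->
  lower_semicontinuous (moreau_obj phi p gamma x).
Proof.
move=> phiNy lscphi y a ay.
have : ((a - pen (x - y))%:E < phi y)%E by rewrite EFinB lteBlDr.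
move=> /lte_fin_gap[d d0 /lscphi[V yV Va]].
pose k := enorm (pen_grad (x - y)).
have k0 : 0 <= k by exact: enorm_ge0.
(* The tangent at x - y shows that the penalty drops by at most k|z - y| < d; the 1 in k + 1 guards
   against k = 0. *)
exists (V `&` [set z | enorm (z - y) < d / (k + 1)]).
  apply: filterI => //; apply/nbhs_enormP; exists (d / (k + 1)) => //.
  by rewrite divr_gt0//; lra.
move=> z [/Va az /=]; rewrite ltr_pdivlMr; last by lra.
move=> zy; rewrite moreau_objE -lteBlDr// -EFinB; apply: le_lt_trans az.
rewrite lee_fin; have := pen_tangent (x - y) (x - z).
rewrite (_ : x - z - (x - y) = y - z); last by rewrite opprB addrC subrKA.
have := normr_ip (pen_grad (x - y)) (y - z).
rewrite ler_norml (enorm_distC y) -/k => /andP[+ _].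
have := enorm_ge0 (z - y).
move: (enorm (z - y)) (pen _) (pen _) (ip _ _) zy; clearbody k.
by clear -k; move=> *; lra.
Qed.

(** Minimality and the tangent inequality at x - z bound phi z - phi y below by <G(x - z), z - y>,
    with G = [pen_grad]. Continuity of G replaces x - z by x - y at a cost of e|z - y|. *)
Lemma prox_frechet_subgrad phi x y :
  (forall y, phi y != -oo%E) -> phi y \is a fin_num ->
  prox phi p gamma x y -> frechet_subgrad phi y (pen_grad (x - y)).
Proof.
move=> phiNy fy xy; split=> // e e0.
have [d d0 dA] := (continuous_enormP _ (x - y)).1 (@pen_grad_continuous (x - y)) e e0.
exists d => // z zy; have := xy z; rewrite !moreau_objE.
move: (phiNy z) fy; case: (phi z) => [s _|_ _ _|//]; last by rewrite leey.
case: (phi y) => [r _|//|//]; rewrite -!EFinD !lee_fin => rs.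
have exy : x - z - (x - y) = y - z by rewrite opprB addrC subrKA.
have := dA (x - z); rewrite exy enorm_distC => /(_ zy) Gd.
have := pen_tangent (x - z) (x - y).
rewrite -[x - y - (x - z)]opprB exy opprB.
have := cauchy_schwarz (pen_grad (x - y) - pen_grad (x - z)) (z - y).
rewrite ipDl ipNl enorm_distC => /le_trans/(_ (ler_wpM2r (enorm_ge0 _) (ltW Gd))).
move: (enorm (z - y)) (pen _) (pen _) (ip _ _) (ip _ _) rs.
by clear -r s e; move=> *; lra.
Qed.

End Penalty.

Arguments pen {R n} p gamma u.
Arguments pen_grad {R n} p gamma u.

(** * Existence and localization of minimizers under calmness *)

Section CalmProx.
Context {R : realType} {n : nat} {p gamma M : R} {phi : 'rV[R]_n -> \bar R}.
Hypotheses (p2 : 2 <= p) (gamma0 : 0 < gamma).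
Hypotheses (phiNy : forall x, phi x != -oo%E) (lscphi : lower_semicontinuous phi).
Hypotheses (phi0 : phi 0 = 0%E) (calm : p_calm phi p M 0).
Hypothesis Mgamma : M < 2 `^ (1 - p) / (p * gamma).
Implicit Types x y : 'rV[R]_n.

Local Notation pen := (@pen R n p gamma).
Let c := 2 `^ (1 - p) / (p * gamma) - M.
Let c0 : 0 < c. Proof. by rewrite subr_gt0. Qed.
Let p0 : 0 < p. Proof. exact: lt_le_trans p2. Qed.
Let p1 : 1 <= p. Proof. by apply: le_trans p2; rewrite ler1n. Qed.
Let pgamma0 : 0 < p * gamma. Proof. by rewrite mulr_gt0. Qed.

Lemma moreau_obj0 x : moreau_obj phi p gamma x 0 = (pen x)%:E.
Proof. by rewrite moreau_objE phi0 add0e subr0. Qed.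

Lemma calm_lower_bound y : ((- (M * enorm y `^ p))%:E <= phi y)%E.
Proof.
have [->|y0] := eqVneq y 0.
  by rewrite phi0 enorm0 powR0 ?gt_eqF// mulr0 oppr0.
have := calm y y0; rewrite phi0 subr0; move: (phiNy y).
case: (phi y) => [r _|_ _|//]; last by rewrite leey.
by rewrite -EFinD !lee_fin lte_fin; move: (M * _) => a; lra.
Qed.

(** Convexity applied to y = x + (y - x) bounds pen x + pen (x - y) below by a multiple of |y|^p,
    from which calmness takes away at most M|y|^p. *)
Lemma moreau_obj_coercive x y :
  ((c * enorm y `^ p - pen x)%:E <= moreau_obj phi p gamma x y)%E.
Proof.
rewrite moreau_objE; apply: le_trans (leeD2r _ (calm_lower_bound y)).
rewrite -EFinD lee_fin; have := enorm_powR_convex x (y - x) p2.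
rewrite subrKC (enorm_distC y x) -(ler_pM2r (_ : 0 < (p * gamma)^-1)) ?invr_gt0//.
rewrite /pen /c mulrDl mulrBl mulrAC.
lra.
Qed.

Lemma prox_enorm_bound x y : prox phi p gamma x y -> c * enorm y `^ p <= 2 * pen x.
Proof.
move=> xy; have := le_trans (moreau_obj_coercive x y) (xy 0).
rewrite moreau_obj0 lee_fin; move: (_ * _) (pen x) => a b; lra.
Qed.

Lemma prox_fin_num x y : prox phi p gamma x y -> phi y \is a fin_num.
Proof.
move=> xy; have := xy 0; rewrite moreau_obj0 moreau_objE; move: (phiNy y).
by case: (phi y).
Qed.

Lemma prox_value_le x y : prox phi p gamma x y -> (phi y <= (pen x)%:E)%E.
Proof.
move=> xy; have := xy 0; rewrite moreau_obj0 moreau_objE; apply: le_trans.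
by rewrite leeDl// lee_fin divr_ge0 ?powR_ge0// ltW.
Qed.

Lemma prox_nonempty x : exists y, prox phi p gamma x y.
Proof.
have pen0 : 0 <= pen x by rewrite divr_ge0 ?powR_ge0// ltW.
(* Outside this ball |z|^p >= |z| > 2 pen x / c, the first inequality because r >= 1; coercivity
   then makes the objective at least pen x, its value at 0. *)
pose r := Num.max 1 (2 * pen x / c).
have r1 : 1 <= r by rewrite le_max lexx.
have objNy y : moreau_obj phi p gamma x y != -oo%E.
  by rewrite moreau_objE; move: (phiNy y); case: (phi y).
have [|y _ ymin] := lower_semicontinuous_attains_min _ _ objNy
  (moreau_obj_lsc p2 gamma0 _ x phiNy lscphi) (@compact_enorm_ball R n r).
  by exists 0; rewrite /= enorm0; exact: le_trans r1.
exists y => z; have [zr|rz] := leP (enorm z) r; first exact: ymin.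
have K0 : enorm (0 : 'rV[R]_n) <= r by rewrite enorm0; exact: le_trans r1.
apply: le_trans (ymin 0 K0) (le_trans _ (moreau_obj_coercive x z)).
rewrite moreau_obj0 lee_fin.
have : r <= enorm z `^ p.
  apply: le_trans (ltW rz) _; apply: le1r_powR => //.
  exact/(le_trans r1)/ltW.
have : 2 * pen x / c <= r by rewrite le_max lexx orbT.
move=> /le_trans h /h; rewrite ler_pdivrMr// [_ `^ _ * _]mulrC.
by move: (_ * _ `^ _) (pen x) => a b; lra.
Qed.

Lemma prox_small (eta : R) : 0 < eta -> exists2 r : R, 0 < r &
  forall x y, enorm x < r -> prox phi p gamma x y ->
    [/\ enorm x <= eta, enorm y <= eta & (phi y < eta%:E)%E].
Proof.
move=> eta0.
(* The bound 1 gives |x|^p <= |x|, hence pen x <= |x| / (p gamma). The last two terms then force 2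
   pen x < c eta^p, which controls y, and pen x < eta, which controls phi y. *)
pose r := Num.min (Num.min 1 eta)
  (Num.min (c * eta `^ p / 2 * (p * gamma)) (eta * (p * gamma))).
exists r; first by rewrite !lt_min ltr01 eta0 !mulr_gt0 ?powR_gt0 ?invr_gt0.
move=> x y; rewrite !lt_min => /andP[/andP[x1 xeta] /andP[xc xp]] xy.
have penx : pen x <= enorm x / (p * gamma).
  rewrite ler_pM2r ?invr_gt0//.
  rewrite -[leRHS]powRr1 ?enorm_ge0//; apply: powR_le1_anti => //.
  by rewrite enorm_ge0 ltW.
rewrite -ltr_pdivrMr// in xc; rewrite -ltr_pdivrMr// in xp.
split; first exact: ltW.
  rewrite leNgt; apply/negP => etay.
  have : eta `^ p < enorm y `^ p.
    by apply: gt0_ltr_powR; rewrite ?nnegrE ?enorm_ge0 ?ltW.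
  rewrite -(ltr_pM2l c0); have := prox_enorm_bound _ _ xy.
  move: (c * _) (c * _) (pen x) (_ / _) penx xc => a1 a2 a3 a4.
  lra.
apply: le_lt_trans (prox_value_le _ _ xy) _; rewrite lte_fin.
exact: le_lt_trans penx xp.
Qed.

End CalmProx.

(** * Growth of the objective around a minimizer *)

Lemma prox_growth {R : realType} {n : nat} (phi : 'rV[R]_n -> \bar R)
    (p q gamma eps rho eta : R) (x y y' : 'rV[R]_n) :
  2 <= p -> p <= q -> 0 < gamma -> 0 <= rho ->
  (forall x, phi x != -oo%E) -> phi 0 = 0%E ->
  q_prox_regular phi q 0 0 eps rho ->
  eta <= 1 / 2 -> eta <= eps -> 2 * eta <= gamma * eps ->
  enorm x <= eta -> enorm y <= eta -> (phi y < eta%:E)%E -> enorm y' <= eta ->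
  prox phi p gamma x y ->
  (phi y + (pen p gamma (x - y)
      + (2 `^ (1 - p) / (p * gamma) - rho / 2) * enorm (y' - y) `^ p)%:E
    <= phi y' + (pen p gamma (x - y'))%:E)%E.
Proof.
move=> p2 pq gamma0 rho0 phiNy phi0 preg eta12 eta_eps eta_gamma.
move=> xeta yeta phiy y'eta xy.
have p1 : 1 <= p by apply: le_trans p2; rewrite ler1n.
have fy : phi y \is a fin_num.
  by move: phiy (phiNy y); case: (phi y).
have xy1 : enorm (x - y) <= 2 * eta.
  by rewrite mulr2n mulrDl mul1r (le_trans (ler_enormD _ _))// enormN lerD.
(* As |x - y| <= 1 and p - 1 >= 1, the subgradient has norm at most |x - y| / gamma <= 2 eta / gamma
   <= eps, so prox-regularity applies to it. *)
have Gsmall : enorm (pen_grad p gamma (x - y) - 0) <= eps.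
  rewrite subr0 enorm_pen_grad// ler_pdivrMr// mulrC.
  apply: le_trans eta_gamma; apply: le_trans xy1.
  rewrite -[leRHS]powRr1 ?enorm_ge0//; apply: powR_le1_anti => //.
    rewrite enorm_ge0/= (le_trans (ler_enormD _ _))// enormN; lra.
  lra.
have ye : enorm (y - 0) <= eps by rewrite subr0 (le_trans yeta).
have y'e : enorm (y' - 0) <= eps by rewrite subr0 (le_trans y'eta).
have phiye : (phi y < phi 0%R + eps%:E)%E.
  by rewrite phi0 add0e (lt_le_trans phiy)// lee_fin.
have lim := frechet_subgrad_limiting _ _ _
  (prox_frechet_subgrad p2 gamma0 _ _ _ phiNy fy xy).
have := preg y _ ye lim Gsmall phiye y' y'e.
(* The linear terms of prox-regularity and of uniform convexity involve the same vector with
   opposite increments, so they cancel on addition. *)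
have := pen_uniform_convex p2 gamma0 (x - y) (x - y').
rewrite (_ : x - y' - (x - y) = y - y'); last by rewrite opprB addrC subrKA.
rewrite -(opprB y' y) ipNr enormN.
(* Since |y' - y| <= 2 eta <= 1 and p <= q, the q-th power error is absorbed by the p-th power. *)
have : rho / 2 * enorm (y' - y) `^ q <= rho / 2 * enorm (y' - y) `^ p.
  apply: ler_wpM2l; first by rewrite divr_ge0.
  apply: powR_le1_anti => //; last exact: lt_le_trans p1.
  by rewrite enorm_ge0/= (le_trans (ler_enormD _ _))// enormN; lra.
rewrite [(_ / _ - _) * _]mulrBl.
move: (phiNy y') fy; case: (phi y') => [s _|_ _ _ _ _|//]; last by rewrite leey.
case: (phi y) => [r _|//|//]; rewrite -!EFinD !lee_fin.
move: (_ * _) (_ * _) (_ * _) (ip _ _) (pen _ _ _) (pen _ _ _) => a1 a2 a3 a4 a5 a6.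
by clear -R; lra.
Qed.

Lemma gamma_bounds {R : realType} (p M rho gamma : R) :
  2 <= p -> 0 < M -> 0 < rho -> 0 < gamma ->
  gamma < Num.min (2 `^ (1 - p) / (M * p)) (1 / (rho * 2 `^ (2 * p - 3))) ->
  M < 2 `^ (1 - p) / (p * gamma) /\ rho / 2 < 2 `^ (1 - p) / (p * gamma).
Proof.
move=> p2 M0 rho0 gamma0; rewrite lt_min.
have p0 : 0 < p by apply: lt_le_trans p2.
have t0 : 0 < 2 `^ (2 * p - 3) :> R by rewrite powR_gt0.
rewrite !ltr_pdivlMr ?mulr_gt0// => /andP[gM grho]; split.
  by rewrite (_ : M * _ = gamma * (M * p)) //; ring.
(* The exponents add up to p - 1, and p <= 2^(p-1); multiplying the bound on gamma by p then gives
   the second claim. *)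
have tE : 2 `^ (2 * p - 3) * 2 `^ (1 - p) * 2 = 2 `^ (p - 1) :> R.
  rewrite -powRD ?pnatr_eq0 ?implybT// -[X in _ * X = _](@powRr1 _ 2)//.
  rewrite -powRD ?pnatr_eq0 ?implybT//; congr (_ `^ _); ring.
have := ge2_le_pow2B1 p2; rewrite -tE => ple.
rewrite -(ltr_pM2l t0).
have : p * (gamma * (rho * 2 `^ (2 * p - 3))) < p * 1 by rewrite ltr_pM2l.
move: ple; move: (2 `^ _) (2 `^ _) => t w. lra.
Qed.

(** * From growth to continuity of the minimizer and smoothness of the envelope *)

Section WellPosedProx.
Context {R : realType} {n : nat} {p gamma c r : R} {phi : 'rV[R]_n -> \bar R}.
Hypotheses (p2 : 2 <= p) (gamma0 : 0 < gamma) (c0 : 0 < c) (r0 : 0 < r).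
Implicit Types x y : 'rV[R]_n.

Local Notation pen := (@pen R n p gamma).
Local Notation pen_grad := (@pen_grad R n p gamma).

Context (P : 'rV[R]_n -> 'rV[R]_n).
Hypotheses (proxP : forall x, prox phi p gamma x (P x))
  (phiP : forall x, phi (P x) \is a fin_num).
Hypothesis small : forall x y, enorm x < r -> prox phi p gamma x y ->
  enorm x <= 1 / 2 /\ enorm y <= 1 / 2.
Hypothesis growth : forall x x' y y', enorm x < r -> enorm x' < r ->
  prox phi p gamma x y -> prox phi p gamma x' y' ->
  (phi y + (pen (x - y) + c * enorm (y' - y) `^ p)%:E
    <= phi y' + (pen (x - y'))%:E)%E.

Let p0 : 0 < p. Proof. exact: lt_le_trans p2. Qed.

Let f x := fine (phi (P x)).
Let fE x : phi (P x) = (f x)%:E. Proof. by rewrite /f fineK. Qed.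

Lemma prox_optimality x x' : f x + pen (x - P x) <= f x' + pen (x - P x').
Proof. by have := proxP x (P x'); rewrite !moreau_objE !fE -!EFinD lee_fin. Qed.

(** Growth from P x to another minimizer y, against the minimality of y, leaves c|y - P x|^p <=
    0. *)
Lemma prox_single_valued x : enorm x < r -> prox phi p gamma x = [set P x].
Proof.
move=> xr; apply/seteqP; split=> [y xy|_ -> //].
have := le_trans (growth _ _ _ _ xr xr (proxP x) xy) (xy (P x)).
rewrite moreau_objE fE -!EFinD lee_fin => h.
have {h} : c * enorm (y - P x) `^ p <= 0.
  by move: h; rewrite addrA gerDl.
rewrite pmulr_rle0// => yP; have : enorm (y - P x) `^ p == 0.
  by rewrite eq_le yP powR_ge0.
by rewrite powR_eq0 enorm_eq0 subr_eq0 => /andP[/eqP].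
Qed.

Lemma prox_continuous x : enorm x < r -> {for x, continuous P}.
Proof.
move=> xr; apply/continuous_enormP => e e0.
(* Growth at x plus optimality at x' bound c|P x' - P x|^p by two penalty differences, each at most
   |x' - x| / gamma. This radius keeps their sum below c e^p. *)
have d0 : 0 < c * e `^ p * gamma / 2 by rewrite !mulr_gt0 ?powR_gt0 ?invr_gt0.
exists (Num.min (c * e `^ p * gamma / 2) (r - enorm x)).
  by rewrite lt_min d0 subr_gt0.
move=> x'; rewrite lt_min => /andP[xx' x'r].
have {}x'r : enorm x' < r.
  have := ler_enormD (x' - x) x; rewrite subrK => /le_lt_trans; apply.
  by rewrite -ltrBrDr.
rewrite ltNge; apply/negP => ee.
have [hx hPx] := small _ _ xr (proxP x).
have [hx' hPx'] := small _ _ x'r (proxP x').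
have := growth _ _ _ _ xr x'r (proxP x) (proxP x').
rewrite !fE -!EFinD lee_fin addrA => g1.
have g2 := prox_optimality x' x.
have g3 : pen (x - P x') - pen (x' - P x') <= enorm (x' - x) / gamma.
  rewrite enorm_distC (_ : x - x' = x - P x' - (x' - P x')); last first.
    by rewrite opprB subrKA.
  apply: (pen_lip p2 gamma0); rewrite (le_trans (ler_enormD _ _))// enormN.
  by rewrite (le_trans (lerD hx hPx'))// -mulrDl divrr ?unitfE.
have g4 : pen (x' - P x) - pen (x - P x) <= enorm (x' - x) / gamma.
  rewrite (_ : x' - x = x' - P x - (x - P x)); last by rewrite opprB subrKA.
  apply: (pen_lip p2 gamma0); rewrite (le_trans (ler_enormD _ _))// enormN.
  by rewrite (le_trans (lerD hx' hPx))// -mulrDl divrr ?unitfE.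
have g5 : c * e `^ p <= c * enorm (P x' - P x) `^ p.
  by rewrite ler_pM2l//; apply: ge0_ler_powR;
    rewrite ?nnegrE ?enorm_ge0// ltW.
have g6 : enorm (x' - x) / gamma < c * e `^ p / 2.
  by rewrite ltr_pdivrMr// mulrAC.
move: g1 g2 g3 g4 g5 g6.
move: (_ * _) (_ * _) (_ / _) (pen _) (pen _) (pen _) (pen _) (f x) (f x').
move=> a1 a2 a3 a4 a5 a6 a7 a8 a9; lra.
Qed.

Lemma envelopeE x : envelope phi p gamma x = (f x + pen (x - P x))%:E.
Proof.
have E : moreau_obj phi p gamma x (P x) = (f x + pen (x - P x))%:E.
  by rewrite moreau_objE fE.
rewrite -E; apply/eqP; rewrite eq_le; apply/andP; split.
  by apply: ereal_inf_lbound; exists (P x).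
by apply/ereal_infP => _ [y _ <-]; exact: proxP.
Qed.

Lemma envelope_C1 :
  C1_on [set x | enorm x < r] (fun x => f x + pen (x - P x)).
Proof.
have sub_cont (u v : 'rV[R]_n) (g : 'rV[R]_n -> 'rV[R]_n) :
    {for u, continuous g} -> {for u, continuous (fun z => pen_grad (g z))}.
  move=> gu; exact: (continuous_comp gu (@pen_grad_continuous _ _ _ _ p2 _)).
exists (fun x => pen_grad (x - P x)); split=> x /= xr.
  apply: (sub_cont x x (fun x => x - P x)).
  exact: (cvgB cvg_id (prox_continuous _ xr)).
move=> e e0.
(* [D1] handles the upper estimate, whose gradient is taken at y - P x with the minimizer frozen;
   [D2] handles the lower one, taken at x - P y, and rests on the continuity of P. *)
have [d1 d10 D1] := (continuous_enormP _ _).1 (sub_cont x x (fun z => z - P x)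
  (cvgB cvg_id (cvg_cst _))) e e0.
have [d2 d20 D2] := (continuous_enormP _ _).1 (sub_cont x x (fun z => x - P z)
  (cvgB (cvg_cst _) (prox_continuous _ xr))) e e0.
exists (Num.min d1 d2); first by rewrite lt_min d10.
move=> y; rewrite lt_min => /andP[/D1 h1 /D2 h2].
have o1 := prox_optimality y x.
have o2 := prox_optimality x y.
have := pen_tangent p2 gamma0 (y - P x) (x - P x).
have := pen_tangent p2 gamma0 (x - P y) (y - P y).
rewrite (_ : y - P y - (x - P y) = y - x); last by rewrite opprB subrKA.
rewrite (_ : x - P x - (y - P x) = - (y - x)); last by rewrite opprB subrKA opprB.
rewrite ipNr => t1 t2.
have b1 : ip (pen_grad (y - P x)) (y - x) - ip (pen_grad (x - P x)) (y - x)
    <= e * enorm (y - x).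
  rewrite -ipNl -ipDl (le_trans (cauchy_schwarz _ _))//.
  by rewrite ler_wpM2r ?enorm_ge0// ltW.
have b2 : ip (pen_grad (x - P x)) (y - x) - ip (pen_grad (x - P y)) (y - x)
    <= e * enorm (y - x).
  rewrite -ipNl -ipDl (le_trans (cauchy_schwarz _ _))//.
  by rewrite ler_wpM2r ?enorm_ge0// enorm_distC ltW.
rewrite ler_norml; move: o1 o2 t1 t2 b1 b2.
move: (e * _) (ip _ _) (ip _ _) (ip _ _) (pen _) (pen _) (pen _) (pen _) (f x) (f y).
move=> a1 a2 a3 a4 a5 a6 a7 a8 a9 a10 *; apply/andP; split; lra.
Qed.

End WellPosedProx.

(** * Choice of the scales and of the neighbourhood *)

Theorem theorem6 (R : realType) (n : nat) (phi : 'rV[R]_n -> \bar R)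
    (p q M eps rho : R) :
  2 <= p -> p <= q -> 0 < M -> 0 < eps -> 0 < rho ->
  proper_fun phi -> lower_semicontinuous phi ->
  phi 0 = 0%E ->
  p_calm phi p M 0 ->
  limiting_subgrad phi 0 0 ->
  q_prox_regular phi q 0 0 eps rho ->
  forall gamma : R, 0 < gamma ->
    gamma < Num.min (2 `^ (1 - p) / (M * p)) (1 / (rho * 2 `^ (2 * p - 3))) ->
  exists U : set 'rV[R]_n,
    [/\ open U, U 0,
        exists P : 'rV[R]_n -> 'rV[R]_n,
          (forall x, U x -> prox phi p gamma x = [set P x]) /\
          (forall x, U x -> {for x, continuous P})
      & exists g : 'rV[R]_n -> R,
          (forall x, U x -> envelope phi p gamma x = (g x)%:E) /\
          C1_on U g].
Proof.
move=> p2 pq M0 eps0 rho0 [phiNy _] lscphi phi0 calm _ preg gamma gamma0 gmin.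
have [Mgamma rhogamma] := gamma_bounds _ _ _ _ p2 M0 rho0 gamma0 gmin.
have prox_ex := prox_nonempty p2 gamma0 phiNy lscphi phi0 calm Mgamma.
pose P x := sval (cid (prox_ex x)).
have proxP x : prox phi p gamma x (P x) by rewrite /P; case: cid.
have phiP x : phi (P x) \is a fin_num.
  exact: prox_fin_num phiNy phi0 _ _ (proxP x).
(* The three terms answer the three smallness conditions of [prox_growth]; 1 / 2 also provides the
   unit bounds behind [pen_lip]. *)
pose eta := Num.min (1 / 2) (Num.min eps (gamma * eps / 2)).
have eta0 : 0 < eta by rewrite !lt_min !divr_gt0 ?mulr_gt0 ?eps0.
have [e1 e2 e3] : [/\ eta <= 1 / 2, eta <= eps & 2 * eta <= gamma * eps].
  split; rewrite -?ler_pdivlMl// ?ge_min ?lexx ?orbT//.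
  by rewrite [2^-1 * _]mulrC lexx !orbT.
have [r r0 small] := prox_small p2 gamma0 phiNy phi0 calm Mgamma _ eta0.
pose c := 2 `^ (1 - p) / (p * gamma) - rho / 2.
have c0 : 0 < c by rewrite subr_gt0.
have growth x x' y y' : enorm x < r -> enorm x' < r ->
    prox phi p gamma x y -> prox phi p gamma x' y' ->
    (phi y + (pen p gamma (x - y)
        + c * enorm (y' - y) `^ p)%:E
      <= phi y' + (pen p gamma (x - y'))%:E)%E.
  (* The competitor y' is within eta of 0 because it is itself a minimizer, for the nearby point
     x'. *)
  move=> xr x'r xy x'y'; have [hx hy hphi] := small _ _ xr xy.
  have [_ hy' _] := small _ _ x'r x'y'.
  exact: (prox_growth _ _ _ _ _ _ _ _ _ _ p2 pq gamma0 (ltW rho0) phiNy phi0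
    preg e1 e2 e3 hx hy hphi hy' xy).
have small2 x y : enorm x < r -> prox phi p gamma x y ->
    enorm x <= 1 / 2 /\ enorm y <= 1 / 2.
  move=> xr /(small _ _ xr)[hx hy _].
  by split; [exact: le_trans hx e1|exact: le_trans hy e1].
exists [set x | enorm x < r]; split.
- apply: (@open_comp _ _ (@enorm R n) [set t : R | t < r]); last exact: open_lt.
  by move=> x _; exact: enorm_continuous.
- by rewrite /= enorm0.
- exists P; split=> x xr.
    exact: (prox_single_valued c0 _ proxP phiP growth).
  exact: (prox_continuous p2 gamma0 c0 _ proxP phiP small2 growth).
- exists (fun x => fine (phi (P x)) + pen p gamma (x - P x)).
  split=> [x _|]; first exact: (envelopeE _ proxP phiP).
  exact: (envelope_C1 p2 gamma0 c0 _ proxP phiP small2 growth).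
Qed.
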